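(* Let $B$ be a real Banach space with $\dim B \geq 2$. Then $C(B) \geq \sqrt{2}$. Moreover, if $\dim B \geq 3$ and $C(B) = \sqrt{2}$, then $B$ is a Hilbert space.
   Context: For a metric space $(X,d)$ and $\mu \geq 0$, say that $(X,d)$ satisfies the $(\mu,0)$-four-point inequality if for all $x,y,z,w\in X$, $d(x,y)+d(z,w)\le \mu\max\{d(x,z)+d(y,w),\ d(x,w)+d(y,z)\}$. The quadrilateral constant of $(X,d)$ is $C_0(X,d)=\inf\{\mu\geq 0 \mid (X,d)\text{ satisfies the }(\mu,0)\text{-four-point inequality}\}$. For a real Banach space $B$ with norm $\|\cdot\|$, $C(B)$ denotes $C_0(B,d)$ where $d(u,v)=\|u-v\|$. ''$B$ is a Hilbert space'' means that the norm of $B$ is induced by an inner product. *)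

(* Defs.v *)
From HB Require Import structures.
From mathcomp Require Import all_boot all_order all_algebra sesquilinear.
From mathcomp Require Import classical_sets reals normedtype.

Set Implicit Arguments.
Unset Strict Implicit.
Unset Printing Implicit Defensive.

Import Order.TTheory GRing.Theory Num.Theory.
Import numFieldNormedType.Exports.

Local Open Scope classical_set_scope.
Local Open Scope ring_scope.

(* The distance is passed as a plain function because a normed module carries
   no canonical [metricType] structure. *)
Definition four_point (R : realType) (X : Type) (d : X -> X -> R) (mu : R)
    : Prop :=
  forall x y z w : X,
    d x y + d z w <= mu * Num.max (d x z + d y w) (d x w + d y z).

(* [inf] on [set R] is the true infimum here: for a metric [d] the set is
   bounded below by 0 and contains 2, by the triangle inequality. *)
Definition quadrilateral_constant (R : realType) (X : Type) (d : X -> X -> R)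
    : R :=
  inf [set mu : R | 0 <= mu /\ four_point d mu].

Definition banach_quadrilateral_constant (R : realType)
    (B : completeNormedModType R) : R :=
  quadrilateral_constant (fun u v : B => `|u - v|).

Definition linearly_independent (R : nzRingType) (V : lmodType R) (n : nat)
    (v : 'I_n -> V) : Prop :=
  forall c : 'I_n -> R, \sum_(i < n) c i *: v i = 0 -> forall i, c i = 0.

(* [\dim] only exists for the finite-dimensional [vectType]; this also covers
   infinite-dimensional spaces. *)
Definition dim_ge (R : nzRingType) (n : nat) (V : lmodType R) : Prop :=
  exists v : 'I_n -> V, linearly_independent v.

(* Over the reals the conjugation is the identity, so [{dot B for idfun}] is
   the type of symmetric positive definite bilinear forms on [B]. *)
Definition is_hilbert (R : realType) (B : completeNormedModType R) : Prop :=
  exists ip : {dot B for (@idfun R)},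
    forall u : B, `|u| = Num.sqrt (ip u u).

(* Main.v *)
Require Import Defs.
From HB Require Import structures.
From mathcomp Require Import all_boot all_order all_algebra sesquilinear.
From mathcomp Require Import classical_sets reals normedtype.
From mathcomp Require Import boolp topology derive.
From mathcomp Require Import ring lra.

(** Applied to the parallelogram u, -u, v, -v, the four-point inequality reads
    |u| + |v| <= mu * max(|u + v|, |u - v|).  As soon as the dimension is at
    least two, the intermediate value theorem provides unit vectors x, y with
    |y + x| = |y - x| = l.  The inequality for the pair (y, x) gives
    2 <= mu * l, and for the pair (y + x, y - x) it gives l <= mu; hence
    mu ^ 2 >= 2.

    When mu = sqrt 2 both inequalities are equalities: unit vectors that are
    isosceles orthogonal satisfy |y + x| = |y - x| = sqrt 2.  For a unit vector
    x, call equator of x the set of these y.  The heart of the proof is that a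
    norm-one functional f with f x = 1 vanishes on the equator of x
    ([support_equator_eq0]).  For y, y' on the equator, the inequality applied
    to x + (y' - y) / 2 and (y + y') / 2 gives
    |f y' - f y| <= 2 * (1 - |(y + y') / 2|).  Projected along x onto a plane,
    the equator is the boundary of a convex figure, so that up to a fixed
    fraction of the oscillation of f itself the right-hand side is of second
    order; such terms add up to something arbitrarily small along a fine
    subdivision, and f is constant along the equator
    ([support_constant_of_line]).  Since the norm may have corners, the sum of
    these terms is controlled by the total variation of the subgradient of a
    convex function instead of a second derivative ([harmonic_rigidity]).  As
    the equator is connected in dimension three and invariant under y |-> -y,
    this constant is zero.

    Consequently, for unit vectors, f_x(y) = 0 means isosceles orthogonality,
    which is symmetric, whereas the left-hand side is linear in y: in dimension
    three, u |-> ker f_u is a polarity of the projective plane.  As in the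
    fundamental theorem of projective geometry, its expression in an orthogonal
    frame is governed by a map of the ground field that has to be multiplicative
    and additive ([polarity_slope_id]), and the only such map of the real field
    is the identity.  Thus the supporting functionals are those of a Euclidean
    norm, and comparing nearby supporting functionals shows that the norm is
    this Euclidean norm on each plane ([pythagoras]).  Then |u| * f_u(v) is
    given by the polarization formula; the former expression is linear in v,
    the latter symmetric, so this is an inner product. *)

Set Implicit Arguments.
Unset Strict Implicit.
Unset Printing Implicit Defensive.

Import Order.TTheory GRing.Theory Num.Theory.
Import numFieldNormedType.Exports.

Local Open Scope classical_set_scope.
Local Open Scope ring_scope.

(** * Linear algebra *)

(** Otherwise n.+1 independent vectors have coordinates in a family of n vectors,
    and the matrix of these coordinates has more rows than columns, hence a
    nontrivial row relation. *)
Lemma exists_outside_span (R : realType) (V : lmodType R) n (w : 'I_n -> V) :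
  dim_ge n.+1 V -> exists z, forall c : 'I_n -> R, z != \sum_i c i *: w i.
Proof.
move=> [v vind]; apply: contrapT => noz.
have /choice[c cP] (i : 'I_n.+1) : exists c : 'I_n -> R, v i = \sum_j c j *: w j.
  apply: contrapT => nc; apply: noz; exists (v i) => c; apply/eqP => vc.
  by apply: nc; exists c.
pose M : 'M[R]_(n.+1, n) := \matrix_(i, j) c i j.
have : kermx M != 0.
  rewrite -mxrank_eq0 mxrank_ker subn_eq0 -ltnNge.
  by rewrite (leq_ltn_trans (rank_leq_col M)).
case/rowV0Pn => d /sub_kermxP dM /eqP; apply; apply/rowP => i; rewrite mxE.
apply: vind (fun i => d 0 i) _ i.
under eq_bigr => i _ do rewrite cP scaler_sumr.
rewrite exchange_big/= big1// => j _.
under eq_bigr => i _ do rewrite scalerA.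
rewrite -scaler_suml; have /rowP/(_ j) := dM.
rewrite !mxE => dMj; rewrite [X in X *: _](_ : _ = 0) ?scale0r// -[RHS]dMj.
by apply: eq_bigr => i _; rewrite mxE.
Qed.

Lemma exists_outside_line (R : realType) (V : lmodType R) (x : V) :
  dim_ge 2 V -> exists z, forall t, z + t *: x != 0.
Proof.
move=> /(exists_outside_span (fun _ : 'I_1 => x))[z hz]; exists z => t.
have := hz (fun=> - t); rewrite big_ord1 scaleNr; apply: contra.
by rewrite addr_eq0.
Qed.

Lemma exists_outside_plane (R : realType) (V : lmodType R) (x y : V) :
  dim_ge 3 V -> exists z, forall s t, z + s *: x + t *: y != 0.
Proof.
move=> /(exists_outside_span (fun i : 'I_2 => if i == 0 then x else y))[z hz].
exists z => s t; have := hz (fun i => if i == 0 then - s else - t).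
rewrite !big_ord_recl big_ord0 addr0 /= !scaleNr -opprD; apply: contra.
by rewrite -addrA addr_eq0.
Qed.

Definition lincomb (R : realType) (V : lmodType R) (x y z : V) (a b c : R) : V :=
  a *: x + b *: y + c *: z.

Lemma lincombD (R : realType) (V : lmodType R) (x y z : V) a b c a' b' c' :
  lincomb x y z a b c + lincomb x y z a' b' c' =
  lincomb x y z (a + a') (b + b') (c + c').
Proof. by rewrite /lincomb !scalerDl addrACA (addrACA (a *: x)). Qed.

Lemma lincombN (R : realType) (V : lmodType R) (x y z : V) a b c :
  - lincomb x y z a b c = lincomb x y z (- a) (- b) (- c).
Proof. by rewrite /lincomb !scaleNr !opprD. Qed.

Lemma lincombZ (R : realType) (V : lmodType R) (x y z : V) a b c k :
  k *: lincomb x y z a b c = lincomb x y z (k * a) (k * b) (k * c).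
Proof. by rewrite /lincomb !scalerDr !scalerA. Qed.

Lemma lincomb0 (R : realType) (V : lmodType R) (x y z : V) : 0 = lincomb x y z 0 0 0.
Proof. by rewrite /lincomb !scale0r !addr0. Qed.

Lemma lincomb1 (R : realType) (V : lmodType R) (x y z : V) : x = lincomb x y z 1 0 0.
Proof. by rewrite /lincomb !scale0r scale1r !addr0. Qed.

Lemma lincomb2 (R : realType) (V : lmodType R) (x y z : V) : y = lincomb x y z 0 1 0.
Proof. by rewrite /lincomb !scale0r scale1r addr0 add0r. Qed.

Lemma lincomb3 (R : realType) (V : lmodType R) (x y z : V) : z = lincomb x y z 0 0 1.
Proof. by rewrite /lincomb !scale0r scale1r !add0r. Qed.

(** Proves an identity between linear combinations of the vectors [x], [y], [z]
    by leaving one scalar goal per coordinate. *)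
Ltac vector_eq x y z :=
  let L := fresh "L" in let LD := fresh in let LN := fresh in let LZ := fresh in
  let L0 := fresh in let L1 := fresh in let L2 := fresh in let L3 := fresh in
  pose proof (lincombD x y z) as LD; pose proof (lincombN x y z) as LN;
  pose proof (lincombZ x y z) as LZ; pose proof (lincomb0 x y z) as L0;
  pose proof (lincomb1 x y z) as L1; pose proof (lincomb2 x y z) as L2;
  pose proof (lincomb3 x y z) as L3;
  set L := lincomb x y z in LD LN LZ L0 L1 L2 L3;
  clearbody L;
  try rewrite ![z]L3; try rewrite ![y]L2; try rewrite ![x]L1;
  try rewrite ![0 in _ = _]L0;
  rewrite ?(LD, LN, LZ);
  congr (L _ _ _); clear L LD LN LZ L0 L1 L2 L3.

(** * Convex functions on the line *)

Lemma eq0_bounded_muln (R : realType) (x C : R) :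
  (forall n : nat, n%:R * `|x| <= C) -> x = 0.
Proof.
move=> h; apply/eqP; rewrite -normr_le0 leNgt; apply/negP => x0.
have C0 : 0 <= C by have := h 0%N; rewrite mul0r.
have := archi_boundP (divr_ge0 C0 (ltW x0)).
rewrite ltr_pdivrMr// => hC.
by have := lt_le_trans hC (h _); rewrite ltxx.
Qed.

(** Along a subdivision of [0, 1] into n equal steps the increments of [psi]
    telescope, so that |a 1 - a 0| is at most (psi 1 - psi 0) / n. *)
Lemma eq_of_increments (R : realType) (a psi : R -> R) :
  (forall s t, 0 <= s -> s <= t -> t <= 1 ->
     `|a t - a s| <= (t - s) * (psi t - psi s)) -> a 1 = a 0.
Proof.
move=> h; apply/subr0_eq/(@eq0_bounded_muln _ _ (psi 1 - psi 0)) => -[|n].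
  rewrite mul0r; have := h 0 1 (lexx _) ler01 (lexx _).
  by rewrite subr0 mul1r; apply: le_trans.
have n0 : 0 < n.+1%:R :> R by rewrite ltr0n.
pose p k : R := k%:R / n.+1%:R.
have step k : (k <= n.+1)%N ->
    n.+1%:R * `|a (p k) - a 0| <= psi (p k) - psi 0.
  elim: k => [|k IH] kn; first by rewrite /p mul0r !subrr normr0 mulr0.
  have pS : p k.+1 - p k = n.+1%:R^-1 by rewrite /p -mulrBl -natrB// subSnn mul1r.
  have hk := h (p k) (p k.+1).
  have {hk} : n.+1%:R * `|a (p k.+1) - a (p k)| <= psi (p k.+1) - psi (p k).
    rewrite -ler_pdivlMl// -pS; apply: hk.
    - by rewrite divr_ge0// ler0n.
    - by rewrite -subr_ge0 pS invr_ge0 ltW.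
    - by rewrite ler_pdivrMr// mul1r ler_nat.
  have {IH} := IH (ltnW kn).
  have : n.+1%:R * `|a (p k.+1) - a 0| <=
         n.+1%:R * `|a (p k.+1) - a (p k)| + n.+1%:R * `|a (p k) - a 0|.
    by rewrite -mulrDr ler_pM2l// ler_distD.
  lra.
have := step n.+1 (leqnn _).
by rewrite /p divff// gt_eqF.
Qed.

Definition convex_fun (R : realType) (mu : R -> R) : Prop :=
  forall s t th, 0 <= th -> th <= 1 ->
    mu ((1 - th) * s + th * t) <= (1 - th) * mu s + th * mu t.

Definition subgradient (R : realType) (mu psi : R -> R) : Prop :=
  forall s t, mu s + psi s * (t - s) <= mu t.

(** The supremum of the slopes to the left of s is bounded by every slope to the
    right of s. *)
Lemma convex_subgradient (R : realType) (mu : R -> R) :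
  convex_fun mu -> exists psi, subgradient mu psi.
Proof.
move=> cvx.
pose L s := [set (mu s - mu t) / (s - t) | t in [set t | t < s]].
have Lub s u : s < u -> ubound (L s) ((mu u - mu s) / (u - s)).
  move=> su _ [t /= ts <-].
  have st0 : 0 < s - t by rewrite subr_gt0.
  have us0 : 0 < u - s by rewrite subr_gt0.
  have ut0 : u - t != 0 by rewrite gt_eqF//; lra.
  have := cvx t u ((s - t) / (u - t)).
  have -> : (1 - (s - t) / (u - t)) * t + (s - t) / (u - t) * u = s by field.
  have th0 : 0 <= (s - t) / (u - t) by rewrite divr_ge0//; lra.
  have th1 : (s - t) / (u - t) <= 1 by rewrite ler_pdivrMr; lra.
  move=> /(_ th0 th1) h.
  have {h} : (u - t) * mu s <= (u - s) * mu t + (s - t) * mu u.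
    have -> : (u - s) * mu t + (s - t) * mu u =
      (u - t) * ((1 - (s - t) / (u - t)) * mu t + (s - t) / (u - t) * mu u) by field.
    by rewrite ler_pM2l//; lra.
  rewrite ler_pdivrMr// mulrAC ler_pdivlMr//; lra.
have L0 s : L s !=set0.
  by exists ((mu s - mu (s - 1)) / (s - (s - 1))), (s - 1) => //=; lra.
exists (fun s => sup (L s)) => s t.
have [ts|st|->] := ltgtP t s; last by rewrite subrr mulr0 addr0.
  have : (mu s - mu t) / (s - t) <= sup (L s).
    apply: ub_le_sup; last by exists t.
    by exists ((mu (s + 1) - mu s) / (s + 1 - s)); apply: Lub; lra.
  rewrite ler_pdivrMr ?subr_gt0//; lra.
have : sup (L s) <= (mu t - mu s) / (t - s).
  by apply: ge_sup; [exact: L0|apply: Lub].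
rewrite ler_pdivlMr ?subr_gt0//; lra.
Qed.

Lemma subgradient_homo (R : realType) (mu psi : R -> R) :
  subgradient mu psi -> {homo psi : s t / s <= t}.
Proof.
move=> sg s t; rewrite le_eqVlt => /predU1P[->//|st].
have := sg s t; have := sg t s => h1 h2.
rewrite -(@ler_pM2r _ (t - s)) ?subr_gt0//; lra.
Qed.

Lemma subgradient_continuous (R : realType) (mu psi : R -> R) :
  subgradient mu psi -> continuous mu.
Proof.
move=> sg s; have mono := subgradient_homo sg.
pose K := `|psi (s - 1)| + `|psi (s + 1)|.
have K0 : 0 <= K by rewrite addr_ge0.
have lip t : `|t - s| <= 1 -> `|mu t - mu s| <= K * `|t - s|.
  rewrite ler_norml => /andP[t1 t2].
  have psib u : s - 1 <= u -> u <= s + 1 -> `|psi u| <= K.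
    move=> /mono u1 /mono u2; rewrite /K.
    have := ler_norm (psi (s + 1))=> h.
    have := ler_norm (- psi (s - 1)); rewrite normrN => h'.
    have := normr_ge0 (psi (s - 1)); have := normr_ge0 (psi (s + 1)).
    by move=> *; rewrite ler_norml; apply/andP; split; lra.
  have bd u : s - 1 <= u -> u <= s + 1 ->
      - (psi u * (t - s)) <= K * `|t - s| /\ psi u * (t - s) <= K * `|t - s|.
    move=> u1 u2; have := psib u u1 u2 => hu.
    have : `|psi u * (t - s)| <= K * `|t - s| by rewrite normrM ler_wpM2r.
    by rewrite ler_norml => /andP[*]; split; lra.
  have [h1 _] := bd s ltac:(lra) ltac:(lra).
  have [_ h2] := bd t ltac:(lra) ltac:(lra).
  have := sg s t; have := sg t s => *.
  by rewrite ler_norml; apply/andP; split; lra.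
apply/cvgrPdist_le => e e0; near=> t.
have t1 : `|t - s| <= 1.
  near: t; apply/nbhs_normP; exists 1 => //= t /=; rewrite distrC => /ltW//.
have : `|t - s| <= e / (K + 1).
  near: t; apply/nbhs_normP; exists (e / (K + 1)); first by rewrite /= divr_gt0//; lra.
  by move=> t /=; rewrite distrC => /ltW.
rewrite ler_pdivlMr; last by lra.
move=> te; rewrite distrC (le_trans (lip t t1))//.
by have := normr_ge0 (t - s); lra.
Unshelve. all: by end_near. Qed.

Lemma convex_gt0_bounded_below (R : realType) (mu psi : R -> R) :
  subgradient mu psi -> (forall s, 0 < mu s) ->
  exists2 d, 0 < d & forall s, 0 <= s -> s <= 1 -> d <= mu s.
Proof.
move=> sg mu0; have cm := subgradient_continuous sg.
have [|c _ hc] := @EVT_min R mu 0 1 ler01.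
  by apply: continuous_subspaceT => x; exact: cm.
by exists (mu c) => // s s0 s1; apply: hc; rewrite in_itv/= s0.
Qed.

(** If the points P, P' of the plane lie on the rays through (s, 1) and (t, 1), at
    heights 1 / mu s and 1 / mu t, their midpoint lies on the ray through
    ([harmonic_point mu s t], 1).  [harmonic_ratio mu s t] is the ratio of this
    midpoint to the point of height 1 / mu on the same ray. *)
Definition harmonic_point (R : realType) (mu : R -> R) (s t : R) : R :=
  (s * mu t + t * mu s) / (mu s + mu t).

Definition harmonic_ratio (R : realType) (mu : R -> R) (s t : R) : R :=
  mu (harmonic_point mu s t) * (mu s + mu t) / (2 * mu s * mu t).

Lemma harmonic_point_between (R : realType) (mu : R -> R) s t :
  (forall s, 0 < mu s) -> s <= t ->
  s <= harmonic_point mu s t <= t.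
Proof.
move=> mu0 st; have ms := mu0 s; have mt := mu0 t.
rewrite /harmonic_point ler_pdivlMr ?ler_pdivrMr ?addr_gt0//.
by apply/andP; split; nra.
Qed.

(** The gap between a convex function and its chord is at most the length of the
    interval times the increment of the subgradient. *)
Lemma harmonic_defect_le (R : realType) (mu psi : R -> R) s t :
  subgradient mu psi -> (forall s, 0 < mu s) ->
  1 - harmonic_ratio mu s t <=
    (t - s) * (psi t - psi s) / (2 * (mu s + mu t)).
Proof.
move=> sg mu0; have ms := mu0 s; have mt := mu0 t.
rewrite /harmonic_ratio; set q := harmonic_point mu s t.
have mst : mu s + mu t != 0 by rewrite gt_eqF// addr_gt0.
have h1 := sg s q; have h2 := sg t q.
have e1 : q - s = (t - s) * mu s / (mu s + mu t) by rewrite /q /harmonic_point; field.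
have e2 : q - t = - ((t - s) * mu t / (mu s + mu t)).
  by rewrite /q /harmonic_point; field.
have ms0 : mu s != 0 by rewrite gt_eqF.
have mt0 : mu t != 0 by rewrite gt_eqF.
rewrite lerBlDr -lerBlDl ler_pdivlMr ?mulr_gt0//.
have -> : (1 - (t - s) * (psi t - psi s) / (2 * (mu s + mu t))) * (2 * mu s * mu t)
  = mu t * (mu s + psi s * (q - s)) + mu s * (mu t + psi t * (q - t)).
  by rewrite e1 e2; field.
have := ler_wpM2l (ltW mt) h1; have := ler_wpM2l (ltW ms) h2; lra.
Qed.

Lemma harmonic_ratio_le1 (R : realType) (mu : R -> R) s t :
  convex_fun mu -> (forall s, 0 < mu s) -> harmonic_ratio mu s t <= 1.
Proof.
move=> cvx mu0; have ms := mu0 s; have mt := mu0 t.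
have mst : mu s + mu t != 0 by rewrite gt_eqF// addr_gt0.
have := cvx s t (mu s / (mu s + mu t)).
have -> : (1 - mu s / (mu s + mu t)) * s + mu s / (mu s + mu t) * t =
   harmonic_point mu s t by rewrite /harmonic_point; field.
have -> : (1 - mu s / (mu s + mu t)) * mu s + mu s / (mu s + mu t) * mu t =
   (2 * mu s * mu t) / (mu s + mu t) by field.
have th0 : 0 <= mu s / (mu s + mu t) by rewrite divr_ge0// ltW// addr_gt0.
have th1 : mu s / (mu s + mu t) <= 1.
  by rewrite ler_pdivrMr ?addr_gt0// mul1r lerDl ltW.
move=> /(_ th0 th1); rewrite ler_pdivlMr ?addr_gt0// => h.
by rewrite /harmonic_ratio ler_pdivrMr ?mulr_gt0// mul1r.
Qed.

(** Let W be the oscillation of [a] on a subinterval [s, t].  The hypothesis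
    bounds W by the convexity defect plus 2 * k * W, and 2 * k < 1, so W is at
    most a multiple of the defect, that is, of (t - s) * (psi t - psi s).  Such
    increments force [a] to be constant. *)
Lemma harmonic_rigidity (R : realType) (mu a : R -> R) (k C : R) :
  convex_fun mu -> (forall s, 0 < mu s) ->
  0 <= C -> 0 <= k -> 2 * k < 1 -> (forall s, `|a s| <= k) ->
  (forall s t, `|a t - a s| <= C * (1 - harmonic_ratio mu s t) +
      2 * k * `|(a s + a t) / 2 - a (harmonic_point mu s t)|) ->
  a 1 = a 0.
Proof.
move=> cvx mu0 C0 k0 k1 ak ha.
have [psi sg] := convex_subgradient cvx.
have mono := subgradient_homo sg.
have [d d0 dmu] := convex_gt0_bounded_below sg mu0.
pose K := C / (4 * d * (1 - 2 * k)).
apply: (@eq_of_increments _ a (fun s => K * psi s)) => s t s0 st t1.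
pose S := [set `|a p.2 - a p.1| |
    p in [set p : R * R | [/\ s <= p.1, p.1 <= p.2 & p.2 <= t]]].
have Sub : has_ubound S.
  exists (2 * k) => _ [[u v] _ <-] /=.
  by rewrite (le_trans (ler_normB _ _))//; have := ak u; have := ak v; lra.
have inS u v : s <= u -> u <= v -> v <= t -> `|a v - a u| <= sup S.
  by move=> *; apply: ub_le_sup => //; exists (u, v).
set W := sup S in inS.
have W0 : 0 <= W by rewrite (le_trans _ (inS s t _ _ _)).
have D0 : 0 <= (t - s) * (psi t - psi s).
  by rewrite mulr_ge0// subr_ge0// mono.
(* Every pair inside [s, t] satisfies the bound, hence so does the supremum W. *)
have bnd u v : s <= u -> u <= v -> v <= t ->
    `|a v - a u| <= C * ((t - s) * (psi t - psi s) / (4 * d)) + 2 * k * W.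
  move=> su uv vt; apply: (le_trans (ha u v)); apply: lerD; last first.
    have /andP[uq qv] := harmonic_point_between mu0 uv.
    set q := harmonic_point mu u v in uq qv *.
    have h1 : `|a q - a u| <= W by apply: inS => //; lra.
    have h2 : `|a v - a q| <= W by apply: inS => //; lra.
    apply: ler_wpM2l; first by lra.
    have -> : (a u + a v) / 2 - a q = ((a v - a q) - (a q - a u)) / 2 by field.
    rewrite normrM [`|2^-1|]ger0_norm; last by lra.
    by have := ler_normB (a v - a q) (a q - a u); lra.
  apply: ler_wpM2l => //; apply: (le_trans (harmonic_defect_le _ _ sg mu0)).
  have du : d <= mu u by apply: dmu; lra.
  have dv : d <= mu v by apply: dmu; lra.
  have h1 : (v - u) * (psi v - psi u) <= (t - s) * (psi t - psi s).
    have p1 := mono _ _ su; have p2 := mono _ _ uv; have p3 := mono _ _ vt.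
    by apply: ler_pM; lra.
  apply: ler_pM => //.
  - by rewrite mulr_ge0// subr_ge0// mono.
  - by rewrite invr_ge0; lra.
  - by rewrite lef_pV2 ?posrE; lra.
have : W <= C * ((t - s) * (psi t - psi s) / (4 * d)) + 2 * k * W.
  apply: ge_sup; first by exists `|a t - a s|, (s, t).
  by move=> _ [[u v] /= [? ? ?] <-]; exact: bnd.
move=> hW; apply: (le_trans (inS s t _ _ _)) => //.
have -> : (t - s) * (K * psi t - K * psi s) =
    C * ((t - s) * (psi t - psi s) / (4 * d)) / (1 - 2 * k).
  by rewrite /K; field; rewrite !gt_eqF//; lra.
by rewrite ler_pdivlMr; lra.
Qed.

(** * Unit vectors isosceles orthogonal to a given one *)

Lemma norm_normalize (R : realType) (B : normedModType R) (u : B) :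
  u != 0 -> `| `|u|^-1 *: u| = 1.
Proof.
by move=> u0; rewrite normrZ ger0_norm ?invr_ge0// mulVf// normr_eq0.
Qed.

Lemma unit_neq0 (R : realType) (B : normedModType R) (e : B) : `|e| = 1 -> e != 0.
Proof. by move=> e1; rewrite -normr_eq0 e1 oner_neq0. Qed.

Local Notation sqrt2 := (Num.sqrt 2).

Lemma sqrt2_sqr (R : realType) : sqrt2 * sqrt2 = 2 :> R.
Proof. by rewrite -expr2 sqr_sqrtr. Qed.

Lemma sqrt2_bounds (R : realType) : 1 < sqrt2 :> R /\ 2 * (sqrt2 - 1) < 1 :> R.
Proof.
have h := @sqrt2_sqr R; have : 0 <= sqrt2 :> R by exact: sqrtr_ge0.
by split; nra.
Qed.

(** The four-point inequality with constant sqrt 2, restricted to the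
    parallelograms centered at the origin and divided by two. *)
Definition diagonal_inequality (R : realType) (B : normedModType R) : Prop :=
  forall u v : B, `|u| + `|v| <= sqrt2 * Num.max `|u + v| `|u - v|.

(** For a unit vector [x] under the diagonal inequality, these are the unit
    vectors isosceles orthogonal to [x]. *)
Definition equator (R : realType) (B : normedModType R) (x y : B) : Prop :=
  [/\ `|y| = 1, `|y + x| = sqrt2 & `|y - x| = sqrt2].

Section Equator.
Variables (R : realType) (B : normedModType R).
Implicit Types x y z u v w : B.

(** The diagonal inequality for (y, x) bounds the common value of the two norms
    from below by sqrt 2, and for (y + x, y - x) from above. *)
Lemma equator_of_isosceles x y : diagonal_inequality B ->
  `|x| = 1 -> `|y| = 1 -> `|y + x| = `|y - x| -> equator x y.
Proof.
move=> diag x1 y1 iso; have s := @sqrt2_sqr R; have [s1 _] := @sqrt2_bounds R.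
have := diag y x; rewrite x1 y1 iso maxxx => h1.
have := diag (y + x) (y - x); rewrite iso.
have -> : y + x + (y - x) = 2 *: y by vector_eq x y y; ring.
have -> : y + x - (y - x) = 2 *: x by vector_eq x y y; ring.
rewrite !normrZ x1 y1 maxxx (ger0_norm (ler0n _ 2)) => h2.
have e : `|y - x| = sqrt2.
  by apply/eqP; rewrite eq_le; apply/andP; split; nra.
by split; rewrite // iso.
Qed.

Lemma equatorN x y : equator x y -> equator x (- y).
Proof.
move=> [y1 p m]; split; first by rewrite normrN.
- by rewrite -m -normrN opprD opprK.
- by rewrite -p -normrN opprB opprK addrC.
Qed.

Lemma equatorC x y : `|x| = 1 -> equator x y -> equator y x.
Proof. by move=> x1 [y1 p m]; split; [|rewrite addrC|rewrite distrC]. Qed.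

(** A convex function with equal values at -1 and 1 is at least this value
    outside the interval. *)
Lemma norm_outside_equator x y (t : R) : equator x y -> 1 <= `|t| ->
  sqrt2 <= `|y + t *: x|.
Proof.
move=> Exy; wlog t0 : y t Exy / 0 <= t => [wl|].
  case: (leP 0 t) => [|t0 t1]; first exact: wl.
  rewrite -normrN opprD -scaleNr; apply: wl; rewrite ?normrN//.
    exact: equatorN.
  by lra.
rewrite ger0_norm// => t1; case: Exy => _ p m.
have e : (t + 1) *: (y + x) = 2 *: (y + t *: x) + (t - 1) *: (y - x).
  by vector_eq x y y; ring.
have := ler_normD (2 *: (y + t *: x)) ((t - 1) *: (y - x)).
rewrite -e !normrZ p m !ger0_norm; lra.
Qed.

(** Convexity of t |-> |y + t x|, with its values at 0 and -1 or 1. *)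
Lemma norm_near_equator x y (t : R) : equator x y ->
  1 - (sqrt2 - 1) * `|t| <= `|y + t *: x|.
Proof.
move=> Exy; wlog t0 : y t Exy / 0 <= t => [wl|].
  case: (leP 0 t) => [|t0]; first exact: wl.
  rewrite -(normrN t) -(normrN (y + _)) opprD -[- (t *: x)]scaleNr.
  apply: wl; last by lra.
  exact: equatorN.
rewrite (ger0_norm t0); case: Exy => y1 p m.
have e : (t + 1) *: y = (y + t *: x) + t *: (y - x).
  by vector_eq x y y; ring.
have := ler_normD (y + t *: x) (t *: (y - x)).
rewrite -e !normrZ y1 m !ger0_norm; lra.
Qed.

(** Project the lens of all z with |z + x| <= sqrt 2 and |z - x| <= sqrt 2 along
    [x].  The points of the equator lie over the boundary of the projection: no
    point of the lens projects further out in the same direction. *)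
Lemma equator_shadow_maximal x y (c t : R) : `|x| = 1 -> equator x y ->
  `|c *: y + t *: x + x| <= sqrt2 -> `|c *: y + t *: x - x| <= sqrt2 -> c <= 1.
Proof.
move=> x1; have [s1 _] := @sqrt2_bounds R.
wlog t0 : y t / 0 <= t => [wl|] Exy.
  case: (leP 0 t) => [t0|t0 h1 h2]; first exact: (wl y t).
  apply: (wl (- y) (- t)); first by lra.
  - exact: equatorN.
  - have -> : c *: - y + - t *: x + x = - (c *: y + t *: x - x).
      by vector_eq x y y; ring.
    by rewrite normrN.
  - have -> : c *: - y + - t *: x - x = - (c *: y + t *: x + x).
      by vector_eq x y y; ring.
    by rewrite normrN.
move=> h _; rewrite leNgt; apply/negP => c1.
have c0 : 0 < c by lra.
have l1 : c^-1 < 1 by rewrite invf_lt1.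
have l0 : 0 < c^-1 by rewrite invr_gt0.
have tc : 0 <= c^-1 * t by rewrite mulr_ge0// ltW.
have := @norm_outside_equator x y (c^-1 * t + 1) Exy.
rewrite ger0_norm; last by lra.
have -> : y + (c^-1 * t + 1) *: x =
    c^-1 *: (c *: y + t *: x + x) + (1 - c^-1) *: x.
  by vector_eq x y y; field; rewrite gt_eqF.
move=> /(_ ltac:(lra)) h3.
have := ler_normD (c^-1 *: (c *: y + t *: x + x)) ((1 - c^-1) *: x).
rewrite !normrZ x1 !ger0_norm; [|lra..].
nra.
Qed.

(** The equator meets each half-plane bounded by the line of [x] at most once:
    its projection along [x] is injective. *)
Lemma equator_shadow_inj x y (c t : R) : `|x| = 1 -> 0 < c -> equator x y ->
  equator x (c *: y + t *: x) -> c = 1 /\ t = 0.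
Proof.
move=> x1 c0 Exy Exz; have [s1 _] := @sqrt2_bounds R.
have c1 : c = 1.
  apply/eqP; rewrite eq_le; apply/andP; split.
    case: Exz => _ p m; apply: (equator_shadow_maximal x1 Exy (t := t)).
      by rewrite p.
    by rewrite m.
  have back : c^-1 *: (c *: y + t *: x) + (- (c^-1 * t)) *: x = y.
    by vector_eq x y y; field; rewrite gt_eqF.
  rewrite -invf_le1//; case: (Exy) => _ p m.
  by apply: (@equator_shadow_maximal x _ _ (- (c^-1 * t)) x1 Exz);
    rewrite back ?p ?m.
split=> //; move: Exz; rewrite {c c0}c1 scale1r.
wlog t0 : y t Exy / 0 <= t => [wl|].
  case: (leP 0 t) => [|t0 /equatorN h]; first exact: wl.
  apply/eqP; rewrite -oppr_eq0; apply/eqP/(wl (- y)).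
  - exact: equatorN.
  - by lra.
  - by rewrite scaleNr -opprD.
case: Exy => y1 p _ [_ p' _].
have e : (t + 1) *: (y + x) = (y + t *: x + x) + t *: y.
  by vector_eq x y y; ring.
have := ler_normD (y + t *: x + x) (t *: y).
rewrite -e !normrZ y1 p p' !ger0_norm; [|lra..].
nra.
Qed.

(** When the component of w along [x] is large and positive, w is closer in
    direction to [x] than to its opposite; this provides the change of sign for
    the intermediate value theorem. *)
Lemma equator_imbalance_ge0 x v w : `|x| = 1 -> w = v + (2 * `|v|) *: x ->
  `|w - `|w| *: x| <= `|w + `|w| *: x|.
Proof.
move=> x1 wE; set M := `|v|; have M0 : 0 <= M by exact: normr_ge0.
have hw : `|(2 * M) *: x| = 2 * M by rewrite normrZ x1 ger0_norm; lra.
have w1 : `|w| <= 3 * M by have := ler_normD v ((2 * M) *: x); rewrite hw -wE -/M; lra.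
have w2 : M <= `|w|.
  have := ler_normB w v.
  have -> : w - v = (2 * M) *: x by rewrite wE addrC addKr.
  by rewrite hw -/M; lra.
have -> : w - `|w| *: x = v + (2 * M - `|w|) *: x.
  by rewrite {1}wE -/M; vector_eq x v v; ring.
have -> : w + `|w| *: x = (2 * M + `|w|) *: x + v.
  by rewrite {1}wE -/M; vector_eq x v v; ring.
have h1 := ler_normD v ((2 * M - `|w|) *: x).
have h2 := ler_normB ((2 * M + `|w|) *: x + v) v.
rewrite addrK normrZ x1 mulr1 ger0_norm in h2; last by lra.
rewrite normrZ x1 mulr1 in h1.
have : `|2 * M - `|w| | <= M by rewrite ler_norml; apply/andP; split; lra.
by rewrite -/M in h1 h2 *; lra.
Qed.

Lemma isosceles_exists x v : `|x| = 1 ->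
  exists a, let w := v + a *: x in `|w + `|w| *: x| = `|w - `|w| *: x|.
Proof.
move=> x1; pose w a := v + a *: x.
pose g a := `|w a + `|w a| *: x| - `|w a - `|w a| *: x|.
have cw : continuous w.
  by move=> a; apply: cvgD; [exact: cvg_cst|apply: cvgZr_tmp].
have cn : continuous (fun a => `|w a| *: x).
  by move=> a; apply: cvgZr_tmp; apply: cvg_norm; exact: cw.
have cg : continuous g.
  move=> a; apply: cvgB; apply: cvg_norm.
    by apply: cvgD; [exact: cw|exact: cn].
  by apply: cvgB; [exact: cw|exact: cn].
set M := `|v|; have M0 : 0 <= M by exact: normr_ge0.
have gM : 0 <= g (2 * M) by rewrite subr_ge0; exact: (equator_imbalance_ge0 (v := v)).
have gN : g (- (2 * M)) <= 0.
  have wN : w (- (2 * M)) = - (- v + (2 * M) *: x).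
    by rewrite /w opprD opprK scaleNr.
  rewrite /g wN normrN subr_le0 -opprD normrN.
  have := equator_imbalance_ge0 (v := - v) x1 erefl; rewrite normrN -/M => h.
  by rewrite -[X in X <= _]normrN opprD opprK.
have [|||a _ ga] := @IVT R g (- (2 * M)) (2 * M) 0.
- by lra.
- by apply: continuous_subspaceT => a; exact: cg.
- by rewrite ge_min gN le_max gM orbT.
by exists a; apply/subr0_eq.
Qed.

Lemma unit_isosceles_exists x v : `|x| = 1 -> (forall t, v + t *: x != 0) ->
  exists a m, let y := m^-1 *: (v + a *: x) in
    [/\ 0 < m, `|y| = 1 & `|y + x| = `|y - x|].
Proof.
move=> x1 vx; have [a iso] := isosceles_exists v x1.
set w := v + a *: x in iso.
have w0 : 0 < `|w| by rewrite normr_gt0 vx.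
have wx s : `|w|^-1 *: w + s *: x = `|w|^-1 *: (w + (s * `|w|) *: x).
  move: `|w| w0 => r r0; clearbody w.
  by vector_eq x w w; field; rewrite gt_eqF.
exists a, `|w|; split=> //.
  by rewrite normrZ gtr0_norm ?invr_gt0// mulVf// gt_eqF.
rewrite -[X in _ + X]scale1r -scaleN1r !wx mul1r mulN1r scaleNr !normrZ.
by congr (_ * _).
Qed.

Lemma equator_exists x v : diagonal_inequality B -> `|x| = 1 ->
  (forall t, v + t *: x != 0) ->
  exists a m, 0 < m /\ equator x (m^-1 *: (v + a *: x)).
Proof.
move=> diag x1 /(unit_isosceles_exists x1)[a [m [m0 y1 iso]]].
by exists a, m; split=> //; exact: equator_of_isosceles.
Qed.
End Equator.

(** * Supporting functionals *)

Definition supports (R : realType) (B : normedModType R) (u : B)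
  (f : {scalar B}) : Prop := f u = `|u| /\ forall v, f v <= `|v|.

Lemma supports_normalize (R : realType) (B : normedModType R) (u : B)
    (f : {scalar B}) :
  u != 0 -> supports u f -> supports (`|u|^-1 *: u) f.
Proof.
move=> u0 [fu fle]; split=> //.
by rewrite linearZ /= fu normrZ ger0_norm ?invr_ge0.
Qed.

Definition sublinear (R : realType) (V : lmodType R) (p : V -> R) : Prop :=
  (forall u v, p (u + v) <= p u + p v) /\
  (forall (c : R) v, 0 <= c -> p (c *: v) <= c * p v).

Lemma sublinearZ (R : realType) (V : lmodType R) (p : V -> R) (c : R) v :
  sublinear p -> 0 <= c -> p (c *: v) = c * p v.
Proof.
move=> [pD pZ]; rewrite le_eqVlt => /predU1P[<-|c0]; apply/eqP; rewrite eq_le.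
  have := pD 0 v; have := pZ 0 v (lexx _).
  by rewrite mul0r scale0r add0r => *; apply/andP; split; lra.
rewrite pZ ?(ltW c0)//= -ler_pdivlMl//.
have := pZ c^-1 (c *: v); rewrite scalerA mulVf ?gt_eqF// scale1r; apply.
by rewrite invr_ge0 ltW.
Qed.

Lemma sublinear_ge (R : realType) (V : lmodType R) (p : V -> R) v :
  sublinear p -> - p (- v) <= p v.
Proof.
move=> sp; have := sp.1 v (- v).
have := sublinearZ 0 sp (lexx 0); rewrite scale0r mul0r subrr => ->; lra.
Qed.

Lemma norm_sublinear (R : realType) (B : normedModType R) :
  sublinear (fun v : B => `|v|).
Proof.
by split=> [u v|c v c0]; [exact: ler_normD|rewrite normrZ ger0_norm].
Qed.

(** The one-sided derivative of [p] at [y] in the direction [v], the difference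
    quotient being written at the scale t = 1 / h. *)
Definition directional (R : realType) (V : lmodType R) (p : V -> R) (y v : V) : R :=
  inf [set p (v + t *: y) - t * p y | t in [set t : R | 0 <= t]].

Section Directional.
Variables (R : realType) (V : lmodType R) (p : V -> R) (y : V).
Hypothesis sp : sublinear p.

Lemma directional_le v t : 0 <= t -> directional p y v <= p (v + t *: y) - t * p y.
Proof.
move=> t0; apply: ge_inf; last by exists t.
exists (- p (- v)) => _ [s /= s0 <-].
have := sp.1 (v + s *: y) (- v); rewrite addrC addKr (sublinearZ y sp s0); lra.
Qed.

Lemma directional_ge v c : (forall t, 0 <= t -> c <= p (v + t *: y) - t * p y) ->
  c <= directional p y v.
Proof.
move=> h; apply: lb_le_inf; first by exists (p (v + 0 *: y) - 0 * p y), 0 => /=.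
by move=> _ [t /= t0 <-]; exact: h.
Qed.

Lemma directional_le_self v : directional p y v <= p v.
Proof. by have := directional_le v (lexx 0); rewrite scale0r addr0 mul0r subr0. Qed.

Lemma directional_sublinear : sublinear (directional p y).
Proof.
split=> [u v|c v].
  rewrite -lerBlDr; apply: directional_ge => t t0.
  rewrite lerBlDr -lerBlDl; apply: directional_ge => s s0.
  rewrite lerBlDl.
  apply: le_trans (directional_le _ (addr_ge0 t0 s0)) _.
  have := sp.1 (u + t *: y) (v + s *: y).
  by rewrite addrACA -scalerDl; lra.
rewrite le_eqVlt => /predU1P[<-|c0].
  rewrite scale0r mul0r (le_trans (directional_le_self _))//.
  by have := sublinearZ 0 sp (lexx 0); rewrite scale0r mul0r => ->.
rewrite -ler_pdivrMl//; apply: directional_ge => t t0.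
rewrite ler_pdivrMl//; have ct : 0 <= c * t by rewrite mulr_ge0// ltW.
apply: le_trans (directional_le _ ct) _.
rewrite -scalerA -scalerDr (sublinearZ _ sp (ltW c0)); lra.
Qed.
End Directional.

(** The directional derivative of [q] at [u] is again sublinear and below [q], so
    minimality gives q v <= q (v + u) - q u. *)
Lemma minimal_sublinear_linear (R : realType) (V : lmodType R) (q : V -> R) :
  sublinear q ->
  (forall p, sublinear p -> (forall v, p v <= q v) -> forall v, q v <= p v) ->
  GRing.linear_for *%R q.
Proof.
move=> sq qmin.
have qD u v : q (u + v) = q u + q v.
  apply/eqP; rewrite eq_le sq.1/=.
  have := qmin _ (directional_sublinear v sq) (directional_le_self v sq) u.
  by have := directional_le v sq u ler01; rewrite scale1r mul1r; lra.
have qN v : q (- v) = - q v.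
  have := sublinearZ 0 sq (lexx 0); rewrite scale0r mul0r.
  by have := qD v (- v); rewrite subrr; lra.
move=> c u v; rewrite qD; congr (_ + _).
case: (leP 0 c) => c0; first exact: sublinearZ.
rewrite -[c *: u]opprK qN -scaleNr (sublinearZ _ sq); last by lra.
by rewrite mulNr opprK.
Qed.

(** Zorn's lemma: the pointwise infimum of a chain of sublinear functions below
    [p] is sublinear, being bounded below by v |-> - p (- v). *)
Lemma minimal_sublinear_exists (R : realType) (V : lmodType R) (p : V -> R) :
  sublinear p -> exists q, [/\ sublinear q, forall v, q v <= p v &
  forall r, sublinear r -> (forall v, r v <= q v) -> forall v, q v <= r v].
Proof.
move=> sp.
pose T := {q : V -> R | sublinear q /\ forall v, q v <= p v}.
pose below (q r : T) := `[< forall v, sval r v <= sval q v >].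
have [|||q qmin] := @ZL_preorder T (exist _ p (conj sp (fun v => lexx _))) below.
- by move=> q; apply/asboolP.
- move=> q r s /asboolP qr /asboolP rs; apply/asboolP => v.
  exact: le_trans (rs v) (qr v).
- move=> A Atot; have [[q0 Aq0]|A0] := pselect (A !=set0); last first.
    by exists (exist _ p (conj sp (fun v => lexx _))) => s As; case: A0; exists s.
  pose F v := [set sval q v | q in A].
  have Fle q v : A q -> inf (F v) <= sval q v.
    move=> Aq; apply: ge_inf; last by exists q.
    exists (- p (- v)) => _ [r _ <-]; case: r => r [sr rp] /=.
    by have := sublinear_ge v sr; have := rp (- v); lra.
  have Fge v c : (forall q, A q -> c <= sval q v) -> c <= inf (F v).
    move=> h; apply: lb_le_inf; first by exists (sval q0 v), q0.
    by move=> _ [q Aq <-]; exact: h.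
  suff sF : sublinear (fun v => inf (F v)) /\ forall v, inf (F v) <= p v.
    by exists (exist _ (fun v => inf (F v)) sF) => q Aq;
      apply/asboolP => v /=; exact: Fle.
  split; last by move=> v; apply: le_trans (Fle _ v Aq0) _; case: q0 {Aq0} => ? [].
  split=> [u v|c v].
    rewrite -lerBlDr; apply: (Fge _ _) => q1 A1.
    rewrite lerBlDr -lerBlDl; apply: (Fge _ _) => q2 A2; rewrite lerBlDl.
    have [/asboolP h|/asboolP h] := Atot _ _ A1 A2.
      apply: le_trans (Fle _ _ A2) _; apply: le_trans ((svalP q2).1.1 _ _) _.
      by rewrite lerD2r; exact: h.
    apply: le_trans (Fle _ _ A1) _; apply: le_trans ((svalP q1).1.1 _ _) _.
    by rewrite lerD2l; exact: h.
  rewrite le_eqVlt => /predU1P[<-|c0].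
    rewrite mul0r; apply: le_trans (Fle _ _ Aq0) _.
    by rewrite (sublinearZ _ (svalP q0).1)// mul0r.
  rewrite -ler_pdivrMl//; apply: (Fge _ _) => q Aq; rewrite ler_pdivrMl//.
  apply: le_trans (Fle _ _ Aq) _.
  by rewrite (sublinearZ _ (svalP q).1 (ltW c0)).
exists (sval q); have [sq qp] := svalP q; split=> // r sr rq.
have rp v : r v <= p v by apply: le_trans (rq v) (qp v).
by have /asboolP := qmin (exist _ r (conj sr rp)) (asboolT rq).
Qed.

(** A linear functional below the directional derivative of the norm at [u] takes
    at - u a value at most - |u|. *)
Lemma supports_exists (R : realType) (B : normedModType R) (u : B) :
  exists f : {scalar B}, supports u f.
Proof.
have sn := @norm_sublinear R B.
have [q [sq qn qmin]] := minimal_sublinear_exists (directional_sublinear u sn).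
have qlin := minimal_sublinear_linear sq qmin.
pose f : {scalar B} := HB.pack q (GRing.isLinear.Build R B R *%R q qlin).
have fn v : f v <= `|v|.
  by apply: le_trans (qn v) _; exact: directional_le_self.
exists f; split=> //; apply/eqP; rewrite eq_le fn/=.
have := directional_le u sn (- u) ler01.
rewrite scale1r addNr normr0 mul1r sub0r => h1.
have h2 : f (- u) <= - `|u| by exact: le_trans (qn (- u)) h1.
by move: h2; rewrite linearN lerN2.
Qed.

(** * A supporting functional is constant on an equator *)

Section Support.
Variables (R : realType) (B : normedModType R) (x : B) (f : {scalar B}).
Hypotheses (diag : diagonal_inequality B) (x1 : `|x| = 1) (fx : supports x f).
Implicit Types y z u v w : B.

Lemma supports_unit : f x = 1. Proof. by rewrite fx.1. Qed.

(** With eta = y' - y, the vectors x + eta / 2 and (y + y') / 2 have sum y' + x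
    and difference - (y - x), both of norm sqrt 2, so the diagonal inequality
    bounds the sum of their norms by 2; and 1 + f eta / 2 is a lower bound for
    the first norm. *)
Lemma support_le_midpoint y y' : equator x y -> equator x y' ->
  f y' - f y <= 2 * (1 - `|2^-1 *: (y + y')|).
Proof.
move=> [_ _ m] [_ p _].
have := diag (x + 2^-1 *: (y' - y)) (2^-1 *: (y + y')).
have -> : x + 2^-1 *: (y' - y) + 2^-1 *: (y + y') = y' + x.
  by vector_eq x y y'; field.
have -> : x + 2^-1 *: (y' - y) - 2^-1 *: (y + y') = - (y - x).
  by vector_eq x y y'; field.
rewrite normrN p m maxxx sqrt2_sqr => h.
have := fx.2 (x + 2^-1 *: (y' - y)).
rewrite linearD supports_unit linearZ linearB /=; lra.
Qed.

Lemma support_dist_le_midpoint y y' : equator x y -> equator x y' ->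
  `|f y' - f y| <= 2 * (1 - `|2^-1 *: (y + y')|).
Proof.
move=> Ey Ey'; rewrite ler_norml; apply/andP; split; last exact: support_le_midpoint.
by have := support_le_midpoint Ey' Ey; rewrite [y' + y]addrC; lra.
Qed.

Lemma support_equator_le y : equator x y -> `|f y| <= sqrt2 - 1.
Proof.
move=> [_ p m]; rewrite ler_norml; apply/andP; split.
  by have := fx.2 (- (y - x)); rewrite normrN m linearN linearB supports_unit; lra.
by have := fx.2 (y + x); rewrite p linearD supports_unit; lra.
Qed.

(** For each s, choose the point Y s of the equator on the half-plane through
    (1 - s) y0 + s y1, and let 1 / mu s be its coordinate along this vector.  As
    the projected lens is convex, mu is a convex function, namely its gauge along
    the line.  The midpoint of Y s and Y t projects onto the ray of a third point
    Y q, so it is rho (Y q + tau x), where rho is the harmonic ratio.  Its norm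
    is estimated by [norm_near_equator], its image under f is computed exactly,
    and tau is eliminated between the two. *)
Lemma support_constant_of_line y0 y1 : equator x y0 -> equator x y1 ->
  (forall s t : R, (1 - s) *: y0 + s *: y1 + t *: x != 0) -> f y1 = f y0.
Proof.
move=> E0 E1 line.
have /choice[h hP] (s : R) : exists am : R * R, 0 < am.2 /\
    equator x (am.2^-1 *: ((1 - s) *: y0 + s *: y1 + am.1 *: x)).
  have [a [m [? ?]]] := equator_exists diag x1 (line s).
  by exists (a, m).
pose al s := (h s).1; pose mu s := (h s).2.
pose Y s := (mu s)^-1 *: ((1 - s) *: y0 + s *: y1 + al s *: x).
have mu0 s : 0 < mu s by case: (hP s).
have EY s : equator x (Y s) by case: (hP s).
have muN s : mu s != 0 by rewrite gt_eqF.
(* The choice of Y is arbitrary, but the equator has one point per half-plane. *)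
have Y0 : Y 0 = y0.
  have := EY 0; have -> : Y 0 = (mu 0)^-1 *: y0 + ((mu 0)^-1 * al 0) *: x.
    by rewrite /Y; move: (mu 0) (al 0) => m a; vector_eq x y0 y1; ring.
  have i0 : 0 < (mu 0)^-1 by rewrite invr_gt0.
  by move=> /(equator_shadow_inj x1 i0 E0)[-> ->]; rewrite scale1r scale0r addr0.
have Y1 : Y 1 = y1.
  have := EY 1; have -> : Y 1 = (mu 1)^-1 *: y1 + ((mu 1)^-1 * al 1) *: x.
    by rewrite /Y; move: (mu 1) (al 1) => m a; vector_eq x y0 y1; ring.
  have i0 : 0 < (mu 1)^-1 by rewrite invr_gt0.
  by move=> /(equator_shadow_inj x1 i0 E1)[-> ->]; rewrite scale1r scale0r addr0.
have cvx : convex_fun mu.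
  move=> s t th th0 th1; set q := _ + _ * t; set c := (1 - th) * mu s + th * mu t.
  have ms := mu0 s; have mt := mu0 t.
  have c0 : 0 < c by rewrite /c; nra.
  have cN : c != 0 by rewrite gt_eqF.
  pose tau := ((1 - th) * al s + th * al t - al q) / c.
  (* The convex combination of Y s and Y t that projects onto the ray of Y q: it
     lies in the lens, so its height there is at most that of Y q. *)
  have zE : (c^-1 * mu q) *: Y q + tau *: x =
      (c^-1 * ((1 - th) * mu s)) *: Y s + (c^-1 * (th * mu t)) *: Y t.
    have := muN s; have := muN t; have := muN q; move: cN.
    rewrite /Y /tau {tau}.
    move: (al q) (mu q) => aq mq; rewrite /c /q.
    move: (mu s) (mu t) (al s) (al t) => ms' mt' as_ at_ *.
    by vector_eq x y0 y1; field; do ?[apply/andP; split].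
  have k0 : 0 <= c^-1 * ((1 - th) * mu s).
    by rewrite !mulr_ge0// ?invr_ge0 ?subr_ge0// ltW.
  have k1 : 0 <= c^-1 * (th * mu t) by rewrite !mulr_ge0// ?invr_ge0// ltW.
  have ksum : c^-1 * ((1 - th) * mu s) + c^-1 * (th * mu t) = 1.
    by rewrite -mulrDr -/c mulVf.
  have bnd : forall e : B, `|Y s + e| = sqrt2 -> `|Y t + e| = sqrt2 ->
      `|(c^-1 * mu q) *: Y q + tau *: x + e| <= sqrt2.
    move=> e hs ht; rewrite zE.
    set k := c^-1 * ((1 - th) * mu s) in k0 ksum *.
    set l := c^-1 * (th * mu t) in k1 ksum *; clearbody k l.
    have -> : k *: Y s + l *: Y t + e = k *: (Y s + e) + l *: (Y t + e).
      by rewrite !scalerDr addrACA -scalerDl ksum scale1r.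
    apply: (le_trans (ler_normD _ _)).
    rewrite !normrZ hs ht (ger0_norm k0) (ger0_norm k1).
    by rewrite -mulrDl ksum mul1r.
  have [_ ps ms'] := EY s; have [_ pt mt'] := EY t.
  have h1 := bnd _ ps pt; have h2 := bnd _ ms' mt'.
  have := equator_shadow_maximal x1 (EY q) h1 h2.
  by rewrite ler_pdivrMl// mulr1.
have [_ kap1] := @sqrt2_bounds R.
have kap0 : 0 <= sqrt2 - 1 :> R by have [? _] := @sqrt2_bounds R; lra.
rewrite -Y0 -Y1; apply: (@harmonic_rigidity R mu (fun s => f (Y s)) (sqrt2 - 1)
  (2 * (1 + (sqrt2 - 1) * (sqrt2 - 1)))) => //.
- by rewrite mulr_ge0// addr_ge0// mulr_ge0.
- by move=> s; exact: support_equator_le.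
move=> s t; set q := harmonic_point mu s t; set rho := harmonic_ratio mu s t.
have rho1 : rho <= 1 by exact: harmonic_ratio_le1.
have rho0 : 0 < rho by rewrite divr_gt0 ?mulr_gt0 ?addr_gt0.
pose tau := (al s / mu s + al t / mu t) / 2 / rho - al q / mu q.
have mE : 2^-1 *: (Y s + Y t) = rho *: (Y q + tau *: x).
  have := muN s; have := muN t; have := muN q.
  have : mu s + mu t != 0 by rewrite gt_eqF// addr_gt0.
  rewrite /Y /tau /rho /harmonic_ratio -/q.
  move: (al q) (mu q) => aq mq; rewrite /q /harmonic_point.
  move: (mu s) (mu t) (al s) (al t) => ms mt as_ at_ *.
  by vector_eq x y0 y1; field; do ?[apply/andP; split].
have := support_dist_le_midpoint (EY s) (EY t).
have fm : (f (Y s) + f (Y t)) / 2 = rho * (f (Y q) + tau).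
  move: mE; move: (Y s) (Y t) (Y q) => a b c /(congr1 f).
  by rewrite !linearZ !linearD !linearZ /= supports_unit mulr1 mulrC.
rewrite mE normrZ gtr0_norm//= => hd.
have ht := norm_near_equator tau (EY q).
(* f (Y q) is at most sqrt2 - 1 in absolute value, so replacing rho by 1 costs
   a multiple of the defect. *)
have hr : rho * `|tau| <=
    `|(f (Y s) + f (Y t)) / 2 - f (Y q)| + (1 - rho) * (sqrt2 - 1).
  have -> : rho * `|tau| = `|rho * tau| by rewrite normrM (gtr0_norm rho0).
  have -> : rho * tau = ((f (Y s) + f (Y t)) / 2 - f (Y q)) + (1 - rho) * f (Y q).
    by rewrite fm; ring.
  apply: (le_trans (ler_normD _ _)); rewrite lerD2l normrM ger0_norm ?subr_ge0//.
  by apply: ler_wpM2l; rewrite ?subr_ge0//; exact: support_equator_le.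
have hr' := ler_wpM2l kap0 hr.
have ht' := ler_wpM2l (ltW rho0) ht.
move: hd hr' ht'; lra.
Qed.
End Support.

(** * Recovering the Euclidean polarity from its slopes *)

(** Squares are sent to squares, so g is nondecreasing; being additive, it fixes
    the natural numbers, hence all reals by the Archimedean property. *)
Lemma multiplicative_additive_id (R : realType) (g : R -> R) :
  g 1 = 1 -> (forall x y, g (x * y) = g x * g y) ->
  (forall x y, g (x + y) = g x + g y) -> forall x, g x = x.
Proof.
move=> g1 gM gD.
have g0 : g 0 = 0 by have := gD 0 0; rewrite addr0; lra.
have gN x : g (- x) = - g x by have := gD x (- x); rewrite subrr; lra.
have gn (n : nat) : g n%:R = n%:R.
  by elim: n => // n IH; rewrite -natr1 gD IH g1.
have gpos x : 0 <= x -> 0 <= g x.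
  by move=> x0; rewrite -[x]sqr_sqrtr// expr2 gM -expr2 sqr_ge0.
have gmono x y : x <= y -> g x <= g y.
  by rewrite -subr_ge0 => /gpos; rewrite gD gN subr_ge0.
suff pos x : 0 <= x -> g x = x.
  move=> x; have [|x0] := leP 0 x; first exact: pos.
  by rewrite -[x]opprK gN pos//; lra.
move=> x0; apply/subr0_eq/(@eq0_bounded_muln _ _ 1) => n.
have nx0 : 0 <= n%:R * x by rewrite mulr_ge0.
rewrite -(ger0_norm (ler0n R n)) -normrM mulrBr -[in n%:R * g x]gn -gM.
have /andP[m1 m2] := truncn_itv nx0.
have := gmono _ _ m1; have := gmono _ _ (ltW m2); rewrite !gn -natr1 => h1 h2.
by rewrite ler_norml; rewrite -natr1 in m2; apply/andP; split; lra.
Qed.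

(** The equivalence expresses that (1, t, r) and (1, b, c) are conjugate for the
    polarity, in either order.  Solving its left-hand side for c, with r = 1 or
    r = -1, turns it into functional equations. *)
Lemma polarity_slope_facts (R : realType) (g h : R -> R) :
  (forall t r b c, 1 + g t * b + h r * c = 0 <-> 1 + g b * t + h c * r = 0) ->
  g 1 = 1 -> h 1 = 1 -> g (-1) = -1 -> h (-1) = -1 ->
  [/\ forall b, h (1 + b) = 1 + g b, forall t, g (g t) = t &
      forall x y, g (x * y) = g x * g y].
Proof.
move=> E g1 h1 gN1 hN1.
have hS b : h (1 + b) = 1 + g b.
  by have [+ _] := E 1 (-1) b (1 + b); rewrite g1 hN1 => /(_ ltac:(lra)); lra.
have hSN b : h (- (1 + b)) = - (1 + g b).
  by have [+ _] := E 1 1 b (- (1 + b)); rewrite g1 h1 => /(_ ltac:(lra)); lra.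
have ggM t b : g (g t * b) = t * g b.
  have [+ _] := E t 1 b (- (1 + g t * b)); rewrite h1 hSN => /(_ ltac:(lra)); lra.
have gg t : g (g t) = t by have := ggM t 1; rewrite g1 !mulr1.
by split=> // x y; rewrite -{1}[x]gg ggM.
Qed.

(** By [polarity_slope_facts] both maps are multiplicative involutions and each
    translation by 1 exchanges them.  Expanding g (1 + y) in two ways shows that
    they coincide; multiplicativity then upgrades compatibility with translation
    by 1 to additivity. *)
Lemma polarity_slope_id (R : realType) (g h : R -> R) :
  (forall t r b c, 1 + g t * b + h r * c = 0 <-> 1 + g b * t + h c * r = 0) ->
  g 1 = 1 -> h 1 = 1 -> g (-1) = -1 -> h (-1) = -1 -> forall t, g t = t.
Proof.
move=> E g1 h1 gN1 hN1.
have [hS gg gM] := polarity_slope_facts E g1 h1 gN1 hN1.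
have [] := @polarity_slope_facts _ h g _ h1 g1 hN1 gN1.
  move=> t r b c; have := E r t c b.
  by rewrite -!addrA ![_ * c + _]addrC ![_ * r + _]addrC.
move=> gS hh hM.
have g0 : g 0 = 0 by have := gS (-1); rewrite hN1 !subrr.
have h0 : h 0 = 0 by have := hS (-1); rewrite gN1 !subrr.
have hneq0 y : y != 0 -> h y != 0.
  by apply: contra => /eqP hy; rewrite -[y]hh hy h0.
have gD' x y : y != 0 -> g (x + y) = g y * (1 + h (x / y)).
  by move=> y0; rewrite -gS -gM; congr g; field.
have hV x y : y != 0 -> h (x / y) = h x / h y.
  by move=> y0; apply: (mulIf (hneq0 _ y0)); rewrite -hM !divfK// hneq0.
have gh y : g y = h y.
  have [->|y0] := eqVneq y 0; first by rewrite g0 h0.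
  have [hy|hy] := eqVneq (h y) (-1); first by rewrite hy -[y]hh hy hN1.
  have := gD' 1 y y0; rewrite gS hV// h1 => e.
  have hy0 := hneq0 _ y0.
  have hy1 : 1 + h y != 0 by rewrite addrC -[1]opprK subr_eq0.
  apply: (mulIf hy1); rewrite {2}e; field.
  exact: hy0.
apply: (multiplicative_additive_id g1 gM) => x y.
have [->|y0] := eqVneq y 0; first by rewrite g0 !addr0.
by rewrite gD'// hV// -!gh; field; rewrite gh hneq0.
Qed.

(** * Orthogonality is a polarity *)

Section Duality.
Variables (R : realType) (B : normedModType R).
Hypotheses (diag : diagonal_inequality B) (dim3 : dim_ge 3 B).
Variable J : B -> {scalar B}.
Hypothesis JP : forall u, supports u (J u).
Implicit Types u v w x y e : B.

(** A third vector z, outside the plane of [x] and [y], yields a point y1 of the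
    equator that can be joined both to y and to - y by a path avoiding the line
    of [x]: f y = f y1 = f (- y). *)
Lemma support_equator_eq0 x y (f : {scalar B}) :
  `|x| = 1 -> supports x f -> equator x y -> f y = 0.
Proof.
move=> x1 fx Ey; have [z hz] := exists_outside_plane x y dim3.
have [|a [m [m0 Ey1]]] := @equator_exists _ _ x z diag x1.
  by move=> t; have := hz t 0; rewrite scale0r addr0.
set y1 := m^-1 *: _ in Ey1.
have im0 : m^-1 != 0 by rewrite gt_eqF// invr_gt0.
(* The argument is the same for y and for - y, that is, for e = 1 and e = -1. *)
suff line (e : R) : `|e| = 1 -> f y1 = f (e *: y).
  have := line (-1); have := line 1; rewrite !normrN normr1.
  by rewrite scale1r scaleN1r linearN => /(_ erefl) h1 /(_ erefl); lra.
move=> e1.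
have Eey : equator x (e *: y).
  move: e1; have [e0|e0] := leP 0 e.
    by rewrite ger0_norm// => ->; rewrite scale1r.
  by rewrite ltr0_norm// => h; rewrite -[e]opprK h scaleN1r; exact: equatorN.
apply: (support_constant_of_line diag x1 fx Eey Ey1) => s t.
have [s0|s0] := eqVneq s 0.
  rewrite s0 subr0 scale1r scale0r addr0; apply/eqP => h.
  have ey : e *: y = - (t *: x) by apply/eqP; rewrite -addr_eq0 h.
  have t1 : `|t| = 1.
    by case: Eey => ey1 _ _; move: ey1; rewrite ey normrN normrZ x1 mulr1.
  have := norm_outside_equator (t := t) Eey; rewrite t1 lexx => /(_ isT).
  by rewrite h normr0; have [] := @sqrt2_bounds R; lra.
have mN : m != 0 by rewrite gt_eqF.
apply/eqP => h.
have /eqP := hz (a + m * t / s) (m * (1 - s) * e / s); apply.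
transitivity ((m / s) *: ((1 - s) *: (e *: y) + s *: y1 + t *: x)); last first.
  by rewrite h scaler0.
by rewrite /y1; vector_eq x y z; field; do ?[apply/andP; split].
Qed.

(** In the plane of [x] and [y] the half-plane through y contains a point
    m^-1 (y + a x) of the equator, where f vanishes; f x = 1 and f y = 0 then
    leave no choice but a = 0. *)
Lemma support_eq0_equator x y (f : {scalar B}) :
  `|x| = 1 -> `|y| = 1 -> supports x f -> f y = 0 -> equator x y.
Proof.
move=> x1 y1 fx fy; have fx1 : f x = 1 by rewrite fx.1.
have [|a [m [m0 Ew]]] := @equator_exists _ _ x y diag x1.
  move=> t; apply/eqP => h; have := congr1 f h.
  rewrite linearD linearZ linear0 /= fx1 fy add0r mulr1 => t0.
  by move: h y1; rewrite t0 scale0r addr0 => ->; rewrite normr0; lra.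
have im0 : 0 < m^-1 by rewrite invr_gt0.
have := support_equator_eq0 x1 fx Ew.
rewrite linearZ linearD linearZ /= fx1 fy add0r mulr1 => /eqP.
rewrite mulf_eq0 gt_eqF//= => /eqP a0; move: (Ew); rewrite a0 scale0r addr0.
case=> + _ _; rewrite normrZ y1 mulr1 gtr0_norm// => m1.
by move: Ew; rewrite a0 scale0r addr0 m1 scale1r.
Qed.

(** Both sides express that the normalized vectors are isosceles orthogonal. *)
Lemma support_eq0C u v : u != 0 -> v != 0 -> J u v = 0 -> J v u = 0.
Proof.
move=> u0 v0 uv; have u1 := norm_normalize u0; have v1 := norm_normalize v0.
have Euv : equator (`|u|^-1 *: u) (`|v|^-1 *: v).
  apply: (support_eq0_equator u1 v1 (supports_normalize u0 (JP u))).
  by rewrite linearZ /= uv mulr0.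
have := support_equator_eq0 v1 (supports_normalize v0 (JP v)) (equatorC u1 Euv).
rewrite linearZ /= => /eqP; rewrite mulf_eq0 invr_eq0 normr_eq0.
by rewrite (negbTE u0) => /eqP.
Qed.

Lemma support_self e : `|e| = 1 -> J e e = 1.
Proof. by move=> e1; rewrite (JP e).1. Qed.

(** The normalized diagonals of the square on e1 and e2 are again isosceles
    orthogonal. *)
Lemma support_eq0_diagonals e1 e2 : `|e1| = 1 -> `|e2| = 1 -> J e1 e2 = 0 ->
  J (e1 + e2) e2 = J (e1 + e2) e1.
Proof.
move=> n1 n2 J12; have [_ p m] := support_eq0_equator n1 n2 (JP e1) J12.
have s2 : sqrt2 != 0 :> R by have [? _] := @sqrt2_bounds R; rewrite gt_eqF//; lra.
have E0 : e1 + e2 != 0 by rewrite -normr_eq0 addrC p.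
have D0 : e2 - e1 != 0 by rewrite -normr_eq0 m.
have P1 := norm_normalize E0; have M1 := norm_normalize D0.
rewrite (addrC e1) p in P1; rewrite m in M1.
have EE : equator (sqrt2^-1 *: (e2 + e1)) (sqrt2^-1 *: (e2 - e1)).
  apply: equator_of_isosceles => //; rewrite -scalerBr -scalerDr !normrZ.
  have -> : e2 - e1 + (e2 + e1) = 2 *: e2 by vector_eq e1 e2 e2; ring.
  have -> : e2 - e1 - (e2 + e1) = - (2 *: e1) by vector_eq e1 e2 e2; ring.
  by rewrite normrN !normrZ n1 n2.
have := supports_normalize E0 (JP (e1 + e2)).
rewrite {1 2}(addrC e1) p => S.
have := support_equator_eq0 P1 S EE.
rewrite linearZ linearB /= => /eqP.
by rewrite mulf_eq0 invr_eq0 (negbTE s2) /= subr_eq0 => /eqP.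
Qed.

(** The functional supporting at e1 + t e2 is proportional to
    (1, [slope e1 e2 t]) in the coordinates dual to e1, e2. *)
Definition slope e1 e2 (t : R) : R := J (e1 + t *: e2) e2 / J (e1 + t *: e2) e1.

Lemma support_frame_neq0 e1 w : `|e1| = 1 -> J e1 w = 1 -> J w e1 != 0.
Proof.
move=> n1 h; apply/eqP => h0.
have w0 : w != 0.
  by apply/eqP => w0; move: h; rewrite w0 linear0 => /eqP; rewrite eq_sym oner_eq0.
by move/eqP: h; rewrite (support_eq0C w0 (unit_neq0 n1) h0) eq_sym oner_eq0.
Qed.

(** The vector k = e2 - slope e1 e2 t * e1 is conjugate to e1 + t e2 by
    definition of the slope, and to e3; so it is conjugate to their sum. *)
Lemma support_slope e1 e2 e3 t r : `|e1| = 1 -> `|e2| = 1 -> `|e3| = 1 ->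
  J e1 e2 = 0 -> J e1 e3 = 0 -> J e2 e3 = 0 ->
  J (e1 + t *: e2 + r *: e3) e2 = slope e1 e2 t * J (e1 + t *: e2 + r *: e3) e1.
Proof.
move=> n1 n2 n3 J12 J13 J23.
have [[z1 z2] z3] := (unit_neq0 n1, unit_neq0 n2, unit_neq0 n3).
have J21 := support_eq0C z1 z2 J12; have J31 := support_eq0C z1 z3 J13.
have J32 := support_eq0C z2 z3 J23.
set u := e1 + t *: e2; set w := u + r *: e3.
have J1u : J e1 u = 1 by rewrite linearD linearZ /= J12 mulr0 addr0 support_self.
have J1w : J e1 w = 1 by rewrite linearD J1u linearZ /= J13 mulr0 addr0.
have u0 := support_frame_neq0 n1 J1u; have w0 := support_frame_neq0 n1 J1w.
have nz v : J e1 v = 1 -> v != 0.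
  by apply: contra_eqN => /eqP ->; rewrite linear0 eq_sym oner_neq0.
set k := e2 - slope e1 e2 t *: e1.
have k0 : k != 0.
  apply/eqP => /(congr1 (J e2)); rewrite linearB linearZ linear0 /= J21 mulr0 subr0.
  by rewrite support_self// => /eqP; rewrite oner_eq0.
have Juk : J u k = 0 by rewrite linearB linearZ /= /slope -/u divfK// subrr.
have Jku := support_eq0C (nz _ J1u) k0 Juk.
have J3k : J e3 k = 0 by rewrite linearB linearZ /= J32 J31 mulr0 subr0.
have Jk3 := support_eq0C z3 k0 J3k.
have Jkw : J k w = 0 by rewrite linearD linearZ /= Jku Jk3 mulr0 addr0.
have := support_eq0C k0 (nz _ J1w) Jkw.
by rewrite linearB linearZ /= => /subr0_eq.
Qed.

Lemma slope_id e1 e2 e3 : `|e1| = 1 -> `|e2| = 1 -> `|e3| = 1 ->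
  J e1 e2 = 0 -> J e1 e3 = 0 -> J e2 e3 = 0 -> forall t, slope e1 e2 t = t.
Proof.
move=> n1 n2 n3 J12 J13 J23.
have [[z1 z2] z3] := (unit_neq0 n1, unit_neq0 n2, unit_neq0 n3).
have J32 := support_eq0C z2 z3 J23.
pose w t r := e1 + t *: e2 + r *: e3.
have J1w t r : J e1 (w t r) = 1.
  by rewrite !linearD !linearZ /= J12 J13 !mulr0 !addr0 support_self.
have wN t r : w t r != 0.
  by apply/eqP => w0; move: (J1w t r); rewrite w0 linear0 => /eqP;
    rewrite eq_sym oner_eq0.
have Jww t r b c : J (w t r) (w b c) =
    J (w t r) e1 * (1 + slope e1 e2 t * b + slope e1 e3 r * c).
  have h2 := support_slope t r n1 n2 n3 J12 J13 J23.
  have h3 := support_slope r t n1 n3 n2 J13 J12 J32.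
  rewrite addrAC in h3; rewrite -/(w t r) in h2 h3.
  by rewrite [w b c]/w 2!linearD 2!linearZ /= h2 h3; ring.
have wz t r : J (w t r) e1 != 0 by apply: support_frame_neq0.
have J0 t r b c : 1 + slope e1 e2 t * b + slope e1 e3 r * c = 0 ->
    1 + slope e1 e2 b * t + slope e1 e3 c * r = 0.
  move=> h; have : J (w t r) (w b c) = 0 by rewrite Jww h mulr0.
  move=> /(support_eq0C (wN _ _) (wN _ _)); rewrite Jww => /eqP.
  by rewrite mulf_eq0 (negbTE (wz _ _)) => /eqP.
(* At 1 and -1 the slope is known: the diagonals of a square are conjugate. *)
have s1 e : `|e| = 1 -> J e1 e = 0 -> slope e1 e 1 = 1.
  move=> n J1e; rewrite /slope scale1r support_eq0_diagonals// divff//.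
  by apply: support_frame_neq0; rewrite // linearD J1e addr0 support_self.
have sN1 e : `|e| = 1 -> J e1 e = 0 -> slope e1 e (-1) = -1.
  move=> n J1e; rewrite /slope scaleN1r.
  have := @support_eq0_diagonals e1 (- e) n1; rewrite normrN linearN J1e oppr0.
  move=> /(_ n erefl); rewrite linearN => h.
  have hz : J (e1 - e) e1 != 0.
    by apply: support_frame_neq0; rewrite // linearB J1e subr0 support_self.
  by rewrite -[J (e1 - e) e]opprK h mulNr divff.
apply: (@polarity_slope_id _ _ (slope e1 e3)).
- by move=> t r b c; split; exact: J0.
- exact: s1.
- exact: s1.
- exact: sN1.
- exact: sN1.
Qed.

Lemma exists_third_axis e1 e2 : `|e1| = 1 -> `|e2| = 1 -> J e1 e2 = 0 ->
  exists e3, [/\ `|e3| = 1, J e1 e3 = 0 & J e2 e3 = 0].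
Proof.
move=> n1 n2 J12; have [z1 z2] := (unit_neq0 n1, unit_neq0 n2).
have J21 := support_eq0C z1 z2 J12.
have [z hz] := exists_outside_plane e1 e2 dim3.
pose u := z + (- J e1 z) *: e1 + (- J e2 z) *: e2.
have u0 : u != 0 by exact: hz.
exists (`|u|^-1 *: u); split; first exact: norm_normalize.
  rewrite linearZ !linearD !linearZ /= J12 support_self//.
  by rewrite mulr1 mulr0 addr0 subrr mulr0.
rewrite linearZ !linearD !linearZ /= J21 support_self//.
by rewrite mulr1 mulr0 addr0 subrr mulr0.
Qed.

(** The functional supporting at e1 + t e2 is proportional to (1, t); evaluated
    at e1 + t' e2 it gives N t * (1 + t t') <= N t' * (1 + t ^ 2), where N t is
    the norm of e1 + t e2.  So N ^ 2 / (1 + t ^ 2) varies between t and t' by at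
    most a multiple of (t - t') ^ 2, hence is constant. *)
Lemma pythagoras_slope e1 e2 s : `|e1| = 1 -> `|e2| = 1 -> J e1 e2 = 0 ->
  `|e1 + s *: e2| ^+ 2 = 1 + s ^+ 2.
Proof.
move=> n1 n2 J12; have [e3 [n3 J13 J23]] := exists_third_axis n1 n2 J12.
pose N t := `|e1 + t *: e2|.
have N0 t : 0 <= N t by exact: normr_ge0.
have NP t t' : N t * (1 + t * t') <= N t' * (1 + t ^+ 2).
  set w := e1 + t *: e2.
  have J1w : J e1 w = 1 by rewrite linearD linearZ /= J12 mulr0 addr0 support_self.
  have h2 : J w e2 = t * J w e1.
    have := support_slope t 0 n1 n2 n3 J12 J13 J23.
    by rewrite scale0r addr0 (slope_id n1 n2 n3).
  have Nt : N t = J w e1 * (1 + t ^+ 2).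
    by rewrite /N -/w -(JP w).1 {2}/w linearD linearZ /= h2; ring.
  have Nt' : J w e1 * (1 + t * t') <= N t'.
    have := (JP w).2 (e1 + t' *: e2); rewrite linearD linearZ /= h2.
    by apply: le_trans; rewrite le_eqVlt; apply/orP; left; apply/eqP; ring.
  rewrite Nt mulrAC; apply: ler_wpM2r => //.
  by rewrite addr_ge0// sqr_ge0.
pose q t := N t ^+ 2 / (1 + t ^+ 2).
have p1 t : 0 < 1 + t ^+ 2 :> R by rewrite ltr_pwDl// sqr_ge0.
have q2 t : q t <= 2.
  rewrite ler_pdivrMr//; have h : N t <= 1 + `|t|.
    by rewrite -{1}n1 -[X in _ + X]mulr1 -n2 -normrZ ler_normD.
  have tt : `|t| ^+ 2 = t ^+ 2 by rewrite real_normK ?num_real.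
  have Nt := N0 t; have t0 := normr_ge0 t; rewrite -tt.
  by rewrite !expr2; have := sqr_ge0 (1 - `|t|); rewrite expr2; nra.
have qd t t' : 0 <= t * t' -> q t - q t' <= 2 * (t - t') ^+ 2.
  move=> tt'; have h : q t * (1 + t * t') ^+ 2 <= q t' * ((1 + t ^+ 2) * (1 + t' ^+ 2)).
    have -> : q t' * ((1 + t ^+ 2) * (1 + t' ^+ 2)) =
      N t' ^+ 2 * (1 + t ^+ 2) ^+ 2 / (1 + t ^+ 2).
      by rewrite /q; field; rewrite !gt_eqF.
    rewrite /q mulrAC; apply: ler_wpM2r; first by rewrite invr_ge0 ltW.
    have g1 : 0 <= N t * (1 + t * t') by rewrite mulr_ge0// addr_ge0.
    by rewrite -!exprMn ler_sqr ?nnegrE// (le_trans g1).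
  have qt' : 0 <= q t' by rewrite divr_ge0 ?sqr_ge0// ltW.
  have e : (1 + t ^+ 2) * (1 + t' ^+ 2) = (1 + t * t') ^+ 2 + (t - t') ^+ 2 by ring.
  have [le|/ltW ge] := leP (q t - q t') 0.
    by apply: (le_trans le); rewrite mulr_ge0// sqr_ge0.
  have d0 : 0 <= (t - t') ^+ 2 by exact: sqr_ge0.
  have h1 : (q t - q t') * (1 + t * t') ^+ 2 <= q t' * (t - t') ^+ 2.
    by rewrite e in h; lra.
  have h2 : 1 <= (1 + t * t') ^+ 2 by rewrite expr2; nra.
  have h3 : q t' * (t - t') ^+ 2 <= 2 * (t - t') ^+ 2 by rewrite ler_wpM2r.
  have h4 : (q t - q t') * 1 <= (q t - q t') * (1 + t * t') ^+ 2 by rewrite ler_wpM2l.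
  by lra.
have : q (s * 1) = q (s * 0).
  apply: (@eq_of_increments R (fun t => q (s * t)) (fun t => 2 * s ^+ 2 * t))
    => a b a0 ab b1.
  have sab : 0 <= (s * a) * (s * b).
    by rewrite mulrACA -expr2 mulr_ge0 ?sqr_ge0// mulr_ge0//; lra.
  have sba : 0 <= (s * b) * (s * a) by rewrite mulrC.
  have := qd _ _ sab; have := qd _ _ sba.
  have -> : (s * b - s * a) ^+ 2 = s ^+ 2 * (b - a) ^+ 2 by ring.
  have -> : (s * a - s * b) ^+ 2 = s ^+ 2 * (b - a) ^+ 2 by ring.
  by rewrite ler_norml => h1 h2; apply/andP; split; rewrite expr2 in h1 h2 *; nra.
rewrite mulr1 mulr0 /q {2}/N scale0r addr0 n1 expr0n addr0 expr1n divr1 => h.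
have ps : 1 + s ^+ 2 != 0 by rewrite gt_eqF.
by rewrite -(divfK ps (`|_| ^+ 2)) -/(N s) h mul1r.
Qed.

Lemma pythagoras e1 e2 (a b : R) : `|e1| = 1 -> `|e2| = 1 -> J e1 e2 = 0 ->
  `|a *: e1 + b *: e2| ^+ 2 = a ^+ 2 + b ^+ 2.
Proof.
move=> n1 n2 J12; have [->|a0] := eqVneq a 0.
  by rewrite scale0r add0r normrZ n2 mulr1 expr0n add0r real_normK ?num_real.
have -> : a *: e1 + b *: e2 = a *: (e1 + (b / a) *: e2).
  by vector_eq e1 e2 e2; field.
rewrite normrZ exprMn pythagoras_slope// real_normK ?num_real//.
by field.
Qed.

Lemma support_polarization u v :
  `|u| * J u v = (`|u + v| ^+ 2 - `|u| ^+ 2 - `|v| ^+ 2) / 2.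
Proof.
have [->|u0] := eqVneq u 0; first by rewrite normr0 mul0r add0r; field.
set e1 := `|u|^-1 *: u; have n1 : `|e1| = 1 := norm_normalize u0.
have r0 : `|u| != 0 by rewrite normr_eq0.
have ue : u = `|u| *: e1 by rewrite /e1 scalerA divff// scale1r.
have Ju1 : J u e1 = 1 by rewrite (supports_normalize u0 (JP u)).1.
set a := J u v; set w := v - a *: e1.
have Juw : J u w = 0 by rewrite linearB linearZ /= Ju1 mulr1 subrr.
have vE : v = a *: e1 + w by rewrite /w addrC subrK.
have uvE : u + v = (`|u| + a) *: e1 + w by rewrite scalerDl -ue -addrA -vE.
have vn : `|v| = `|a *: e1 + w| by rewrite -vE.
rewrite uvE vn.
have [w0|w0] := eqVneq w 0.
  rewrite w0 !addr0 !(normrZ _ e1) n1 !mulr1.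
  by rewrite !real_normK ?num_real//; field.
set e2 := `|w|^-1 *: w; have n2 : `|e2| = 1 := norm_normalize w0.
have we : w = `|w| *: e2 by rewrite /e2 scalerA divff ?scale1r// normr_eq0.
have J2u : J e2 u = 0.
  apply: support_eq0C => //; first exact: unit_neq0.
  by rewrite linearZ /= Juw mulr0.
(* Symmetry used twice replaces the functional J u by J e1. *)
have J12 : J e1 e2 = 0.
  apply: support_eq0C; try exact: unit_neq0.
  by rewrite linearZ /= J2u mulr0.
rewrite we !pythagoras//.
by field.
Qed.

(** By [support_polarization], |u| * J u v is symmetric in u and v. *)
Lemma hilbert_of_support : exists ip : {dot B for (@idfun R)},
    forall u : B, `|u| = Num.sqrt (ip u u).
Proof.
pose op u v := `|u| * J u v.
have opC u v : op u v = op v u.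
  by rewrite /op !support_polarization (addrC u); field.
have opr u : GRing.linear_for *%R (op u).
  by move=> c v w; rewrite /op linearD linearZ /=; ring.
have opl u : GRing.linear_for *%R (op^~ u).
  by move=> c v w; rewrite /= opC opr !(opC u).
have opp u : op u u = `|u| ^+ 2 by rewrite /op (JP u).1.
have opH u v : op u v = (-1) ^+ false * idfun (op v u) by rewrite mul1r.
have oppos u : u != 0 -> 0 < op u u.
  by move=> u0; rewrite opp exprn_gt0// normr_gt0.
pose bil := bilinear_isBilinear.Build R B B R *%R (@idfun R \; *%R) op (conj opl opr).
pose her := isHermitianSesquilinear.Build R B false (@idfun R) op opH.
pose dot := isDotProduct.Build R B op oppos.
exists (HB.pack_for {dot B for @idfun R} op bil her dot) => u /=.
by rewrite opp sqrtr_sqr normr_id.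
Qed.
End Duality.

Lemma diagonal_inequality_hilbert (R : realType) (B : completeNormedModType R) :
  diagonal_inequality B -> dim_ge 3 B -> is_hilbert B.
Proof.
move=> diag dim3; have /choice[J JP] := @supports_exists R B.
exact: hilbert_of_support diag dim3 J JP.
Qed.

(** * The quadrilateral constant *)

Lemma four_point_diagonal (R : realType) (B : normedModType R) (mu : R) (u v : B) :
  four_point (fun u v : B => `|u - v|) mu ->
  `|u| + `|v| <= mu * Num.max `|u + v| `|u - v|.
Proof.
move=> /(_ u (- u) v (- v)).
have -> : u - - u = 2 *: u by vector_eq u v v; ring.
have -> : v - - v = 2 *: v by vector_eq u v v; ring.
have -> : - u - - v = - (u - v) by vector_eq u v v; ring.
have -> : - u - v = - (u + v) by vector_eq u v v; ring.
rewrite opprK !normrN !normrZ !(ger0_norm (ler0n _ 2)) maxC.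
have dbl (r : R) : r + r = 2 * r by ring.
by rewrite !dbl -maxr_pMr// mulrCA -mulrDr ler_pM2l.
Qed.

(** For isosceles orthogonal unit vectors x, y and l = |y + x| = |y - x|, the
    diagonals of the parallelograms on (y, x) and on (y + x, y - x) give
    2 <= mu * l and l <= mu. *)
Lemma sqrt2_le_four_point (R : realType) (B : normedModType R) (mu : R) :
  dim_ge 2 B -> 0 <= mu -> four_point (fun u v : B => `|u - v|) mu ->
  sqrt2 <= mu.
Proof.
move=> dim2 mu0 fp.
(* Being outside the line of 0 means being nonzero. *)
have [z hz] := exists_outside_line (0 : B) dim2.
have z0 : z != 0 by have := hz 0; rewrite scaler0 addr0.
move: (_ *: z) (norm_normalize z0) => x x1.
have [v hv] := exists_outside_line x dim2.
have [a [m /= [m0 y1 iso]]] := unit_isosceles_exists x1 hv.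
move: (m^-1 *: _) y1 iso => y y1 iso.
have h1 := four_point_diagonal y x fp; rewrite iso maxxx y1 x1 in h1.
have := four_point_diagonal (y + x) (y - x) fp; rewrite iso.
have -> : y + x + (y - x) = 2 *: y by vector_eq x y y; ring.
have -> : y + x - (y - x) = 2 *: x by vector_eq x y y; ring.
rewrite !normrZ y1 x1 maxxx (ger0_norm (ler0n _ 2)) => h2.
have := @sqrt2_sqr R; have : 0 <= sqrt2 :> R by exact: sqrtr_ge0.
by rewrite leNgt => s0 ss; apply/negP => lt; nra.
Qed.

Lemma four_point2 (R : realType) (B : normedModType R) :
  four_point (fun u v : B => `|u - v|) 2.
Proof.
move=> x y z w.
have h1 := ler_distD z x y; have h2 := ler_distD w x y.
have h3 := ler_distD x z w; have h4 := ler_distD y z w.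
rewrite (distrC z y) (distrC w y) (distrC z x) in h1 h2 h3 h4.
set A := `|x - z| + `|y - w|; set A' := `|x - w| + `|y - z|.
have a1 : A <= Num.max A A' by rewrite le_max lexx.
have a2 : A' <= Num.max A A' by rewrite le_max lexx orbT.
by rewrite /A /A' in a1 a2 *; lra.
Qed.

Lemma diagonal_inequality_of_constant (R : realType) (B : completeNormedModType R) :
  banach_quadrilateral_constant B <= sqrt2 -> diagonal_inequality B.
Proof.
move=> C u v; set M := Num.max _ _.
have M0 : 0 <= M by rewrite le_max normr_ge0.
have muM mu : four_point (fun u v : B => `|u - v|) mu -> `|u| + `|v| <= mu * M.
  exact: four_point_diagonal.
move: M0; rewrite le_eqVlt => /predU1P[M0|M0].
  by have := muM _ (@four_point2 R B); rewrite -M0 !mulr0.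
rewrite -ler_pdivrMr//; apply: le_trans C.
apply: lb_le_inf; first by exists 2; split=> //; exact: four_point2.
by move=> mu [_ /muM]; rewrite ler_pdivrMr.
Qed.

Theorem theorem5p8 (R : realType) (B : completeNormedModType R)
    (dimB : dim_ge 2 B) :
  Num.sqrt 2 <= banach_quadrilateral_constant B /\
  (dim_ge 3 B -> banach_quadrilateral_constant B = Num.sqrt 2 ->
   is_hilbert B).
Proof.
split.
  apply: lb_le_inf; first by exists 2; split=> //; exact: four_point2.
  by move=> mu [mu0 fp]; exact: sqrt2_le_four_point dimB mu0 fp.
move=> dim3 C; apply: diagonal_inequality_hilbert => //.
by apply: diagonal_inequality_of_constant; rewrite C.
Qed.
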